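(* Let $A$ be any commutative ring with identity, let $f\in A$, and let $X=\operatorname{Spec}_R A$ be the real Zariski spectrum of $A$ with its sheaf of rings $\mathcal{O}_X$. Then the canonical ring homomorphism $\psi\colon\Sigma_f^{-1}A\to\mathcal{O}_X(D(f))$, sending $\frac{a}{f^{2n}+\sum_i x_i^2}$ (with $a,x_i\in A$, $n\ge 0$) to the section $s$ given by $s(\mathfrak{p})=\frac{a}{f^{2n}+\sum_i x_i^2}\in A_{\mathfrak{p}}$ for all $\mathfrak{p}\in D(f)$, is injective.
   Context: All rings are commutative with identity. An ideal $I$ of $A$ is real if whenever $a_1^2+\cdots+a_n^2\in I$ with $a_i\in A$, then all $a_i\in I$. A real prime ideal is a prime ideal that is real. The real Zariski spectrum $\operatorname{Spec}_R A$ is the set of all real prime ideals of $A$, with the topology whose closed sets are the sets $V(I)=\{\mathfrak{p}\in\operatorname{Spec}_R A : \mathfrak{p}\supseteq I\}$ for ideals $I$ of $A$. For $f\in A$, $D(f)=\{\mathfrak{p}\in \operatorname{Spec}_R A: f\notin\mathfrak{p}\}$; these sets form a basis of the topology. The sheaf $\mathcal{O}_X$ on $X=\operatorname{Spec}_R A$: for $U\subseteq X$ open, $\mathcal{O}_X(U)$ is the ring (under pointwise operations) of all functions $s\colon U\to\coprod_{\mathfrak{p}\in X}A_{\mathfrak{p}}$ such that (1) $s(\mathfrak{p})\in A_{\mathfrak{p}}$ for all $\mathfrak{p}\in U$; (2) for each $\mathfrak{p}\in U$ there are an open neighborhood $U_{\mathfrak{p}}\subseteq U$ of $\mathfrak{p}$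 and elements $a,g\in A$ such that for all $\mathfrak{q}\in U_{\mathfrak{p}}$ one has $g\notin\mathfrak{q}$ and $s(\mathfrak{q})=\frac{a}{g}\in A_{\mathfrak{q}}$. Restriction maps are restrictions of functions. For $f\in A$, $\Sigma_f=\{f^{2m}+\sum_{i=1}^n a_i^2 : a_i\in A,\ m\in\mathbb{N}\cup\{0\},\ n\in\mathbb{N}\}$ (with $f^0=1$), a multiplicative subset of $A$. $\Sigma_f^{-1}A$ denotes the localization of $A$ at $\Sigma_f$ (it is the zero ring if $0\in\Sigma_f$). *)

(* Defs.v *)
From HB Require Import structures.
From mathcomp Require Import all_boot all_algebra ring.
From mathcomp Require Import all_classical.
From mathcomp Require Import topology.

Set Implicit Arguments.
Unset Strict Implicit.
Unset Printing Implicit Defensive.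

Import GRing.Theory.
Local Open Scope classical_set_scope.
Local Open Scope ring_scope.
Local Open Scope quotient_scope.

(* Rings are [comPzRingType]s: the zero ring is allowed, both as the base ring
   and as a localization. *)

(* The localization of A at a multiplicative set S, which may contain zero
   divisors: (a, s) and (b, t) are identified when u (a t - b s) = 0 for some
   u in S. *)
Section Localization.
Variables (A : comPzRingType) (S : mulrClosed A).

Definition predfrac := (A * {s : A | s \in S})%type.

Definition loc_equiv : rel predfrac := fun x y =>
  `[< exists2 u, u \in S & u * (x.1 * val y.2 - y.1 * val x.2) = 0 >].

Lemma loc_equiv_refl : reflexive loc_equiv.
Proof. by move=> x; apply/asboolP; exists 1; rewrite ?rpred1// subrr mulr0. Qed.

Lemma loc_equiv_sym : symmetric loc_equiv.
Proof.
by move=> x y; apply/asboolP/asboolP => -[u uS e]; exists u => //;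
  rewrite -opprB mulrN e oppr0.
Qed.

Lemma loc_equiv_trans : transitive loc_equiv.
Proof.
move=> [b [t tS]] [a [s sS]] [c [r rS]].
move=> /asboolP[/= u uS e1] /asboolP[/= v vS e2].
apply/asboolP; exists (u * v * t); rewrite ?rpredM//=.
have -> : u * v * t * (a * r - c * s) =
  v * r * (u * (a * t - b * s)) + u * s * (v * (b * r - c * t)) by ring.
by rewrite e1 e2 !mulr0 addr0.
Qed.

Canonical loc_equiv_rel :=
  EquivRel loc_equiv loc_equiv_refl loc_equiv_sym loc_equiv_trans.

Definition loc := {eq_quot loc_equiv}.
HB.instance Definition _ : EqQuotient _ loc_equiv loc := EqQuotient.on loc.
HB.instance Definition _ := Choice.on loc.

Definition frac (a s : A) (hs : s \in S) : loc := \pi_loc (a, exist _ s hs).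

Lemma fracP a s (hs : s \in S) b t (ht : t \in S) :
  frac a hs = frac b ht <-> exists2 u, u \in S & u * (a * t - b * s) = 0.
Proof.
split; first by move/eqmodP/asboolP.
by move=> h; apply/eqmodP/asboolP.
Qed.

Lemma frac_surj (x : loc) : exists a s (hs : s \in S), x = frac a hs.
Proof. by elim/quotW: x => -[a [s hs]]; exists a, s, hs. Qed.

Lemma frac_eq a s (hs : s \in S) b t (ht : t \in S) :
  a * t = b * s -> frac a hs = frac b ht.
Proof.
by move=> e; apply/fracP; exists 1; rewrite ?rpred1// e subrr mulr0.
Qed.

Definition num (x : loc) : A := (repr x).1.
Definition den (x : loc) : A := val (repr x).2.
Lemma den_in x : den x \in S. Proof. exact: valP. Qed.

Lemma frac_num_den x : frac (num x) (den_in x) = x.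
Proof.
rewrite -[RHS]reprK /frac; congr (\pi_loc _).
by rewrite [RHS]surjective_pairing; congr pair; apply: val_inj.
Qed.

Definition loc0 := frac 0 (rpred1 S).
Definition loc1 := frac 1 (rpred1 S).
Definition loc_opp x := frac (- num x) (den_in x).
Definition loc_add x y :=
  frac (num x * den y + num y * den x) (rpredM (den_in x) (den_in y)).
Definition loc_mul x y :=
  frac (num x * num y) (rpredM (den_in x) (den_in y)).

Lemma loc_oppE a s (hs : s \in S) : loc_opp (frac a hs) = frac (- a) hs.
Proof.
have /fracP[u uS e] := frac_num_den (frac a hs).
apply/fracP; exists u => //.
by rewrite !mulNr -opprD mulrN e oppr0.
Qed.

Lemma loc_addE a s (hs : s \in S) b t (ht : t \in S) :
  loc_add (frac a hs) (frac b ht) = frac (a * t + b * s) (rpredM hs ht).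
Proof.
rewrite /loc_add.
have /fracP[u uS e1] := frac_num_den (frac a hs).
have /fracP[v vS e2] := frac_num_den (frac b ht).
move: (num _) (den _) (den_in _) e1 => a' s' hs' e1.
move: (num _) (den _) (den_in _) e2 => b' t' ht' e2.
apply/fracP; exists (u * v); rewrite ?rpredM//.
have -> : u * v * ((a' * t' + b' * s') * (s * t) - (a * t + b * s) * (s' * t'))
  = v * t * t' * (u * (a' * s - a * s')) + u * s * s' * (v * (b' * t - b * t'))
  by ring.
by rewrite e1 e2 !mulr0 addr0.
Qed.

Lemma loc_mulE a s (hs : s \in S) b t (ht : t \in S) :
  loc_mul (frac a hs) (frac b ht) = frac (a * b) (rpredM hs ht).
Proof.
rewrite /loc_mul.
have /fracP[u uS e1] := frac_num_den (frac a hs).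
have /fracP[v vS e2] := frac_num_den (frac b ht).
move: (num _) (den _) (den_in _) e1 => a' s' hs' e1.
move: (num _) (den _) (den_in _) e2 => b' t' ht' e2.
apply/fracP; exists (u * v); rewrite ?rpredM//.
have -> : u * v * (a' * b' * (s * t) - a * b * (s' * t'))
  = v * b' * t * (u * (a' * s - a * s')) + u * a * s' * (v * (b' * t - b * t'))
  by ring.
by rewrite e1 e2 !mulr0 addr0.
Qed.

Fact loc_addA : associative loc_add.
Proof.
move=> x y z; have [a [s [hs ->]]] := frac_surj x.
have [b [t [ht ->]]] := frac_surj y; have [c [r [hr ->]]] := frac_surj z.
by rewrite !loc_addE; apply: frac_eq; ring.
Qed.

Fact loc_addC : commutative loc_add.
Proof.
move=> x y; have [a [s [hs ->]]] := frac_surj x.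
have [b [t [ht ->]]] := frac_surj y.
by rewrite !loc_addE; apply: frac_eq; ring.
Qed.

Fact loc_add0 : left_id loc0 loc_add.
Proof.
move=> x; have [a [s [hs ->]]] := frac_surj x.
by rewrite !loc_addE; apply: frac_eq; ring.
Qed.

Fact loc_addN : left_inverse loc0 loc_opp loc_add.
Proof.
move=> x; have [a [s [hs ->]]] := frac_surj x.
by rewrite loc_oppE !loc_addE; apply: frac_eq; ring.
Qed.

HB.instance Definition _ :=
  GRing.isZmodule.Build loc loc_addA loc_addC loc_add0 loc_addN.

Fact loc_mulA : associative loc_mul.
Proof.
move=> x y z; have [a [s [hs ->]]] := frac_surj x.
have [b [t [ht ->]]] := frac_surj y; have [c [r [hr ->]]] := frac_surj z.
by rewrite !loc_mulE; apply: frac_eq; ring.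
Qed.

Fact loc_mulC : commutative loc_mul.
Proof.
move=> x y; have [a [s [hs ->]]] := frac_surj x.
have [b [t [ht ->]]] := frac_surj y.
by rewrite !loc_mulE; apply: frac_eq; ring.
Qed.

Fact loc_mul1 : left_id loc1 loc_mul.
Proof.
move=> x; have [a [s [hs ->]]] := frac_surj x.
by rewrite !loc_mulE; apply: frac_eq; ring.
Qed.

Fact loc_mulDl : left_distributive loc_mul loc_add.
Proof.
move=> x y z; have [a [s [hs ->]]] := frac_surj x.
have [b [t [ht ->]]] := frac_surj y; have [c [r [hr ->]]] := frac_surj z.
by rewrite !(loc_addE, loc_mulE); apply: frac_eq; ring.
Qed.

HB.instance Definition _ :=
  GRing.Zmodule_isComPzRing.Build loc loc_mulA loc_mulC loc_mul1 loc_mulDl.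

Lemma frac0 s (hs : s \in S) : frac 0 hs = 0.
Proof. by apply: frac_eq; ring. Qed.

Lemma frac1 : frac 1 (rpred1 S) = 1.
Proof. by []. Qed.

Lemma fracN a s (hs : s \in S) : - frac a hs = frac (- a) hs.
Proof. exact: loc_oppE. Qed.

Lemma fracD a s (hs : s \in S) b t (ht : t \in S) :
  frac a hs + frac b ht = frac (a * t + b * s) (rpredM hs ht).
Proof. exact: loc_addE. Qed.

Lemma fracM a s (hs : s \in S) b t (ht : t \in S) :
  frac a hs * frac b ht = frac (a * b) (rpredM hs ht).
Proof. exact: loc_mulE. Qed.

End Localization.

(* The ring homomorphism a / s |-> a / s between localizations of A at S and at
   a larger multiplicative set T; see [loc_map_frac]. *)
Section LocalizationMap.
Variables (A : comPzRingType) (S T : mulrClosed A).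
Variable ST : {subset S <= T}.

Definition loc_map (x : loc S) : loc T := frac (num x) (ST (den_in x)).

Lemma loc_map_frac a s (hs : s \in S) : loc_map (frac a hs) = frac a (ST hs).
Proof.
have /fracP[u uS e] := frac_num_den (frac a hs).
by apply/fracP; exists u => //; exact: ST.
Qed.

Fact loc_map_is_zmod_morphism : zmod_morphism loc_map.
Proof.
move=> x y; have [a [s [hs ->]]] := frac_surj x.
have [b [t [ht ->]]] := frac_surj y.
by rewrite fracN fracD !loc_map_frac fracN fracD; apply: frac_eq.
Qed.

Fact loc_map_is_monoid_morphism : monoid_morphism loc_map.
Proof.
split=> [|x y]; first by rewrite -!frac1 loc_map_frac; apply: frac_eq.
have [a [s [hs ->]]] := frac_surj x; have [b [t [ht ->]]] := frac_surj y.
by rewrite fracM !loc_map_frac fracM; apply: frac_eq.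
Qed.

HB.instance Definition _ := GRing.isZmodMorphism.Build (loc S) (loc T) loc_map
  loc_map_is_zmod_morphism.
HB.instance Definition _ := GRing.isMonoidMorphism.Build (loc S) (loc T) loc_map
  loc_map_is_monoid_morphism.

End LocalizationMap.

(* Ideals need not be proper. The ideals of [ring_quotient] are proper, and are
   only defined over nonzero rings. *)
Section RealIdeals.
Variable A : comPzRingType.
Implicit Type I : set A.

Definition is_ideal I := [/\ I 0,
  forall x y, I x -> I y -> I (x + y) & forall a x, I x -> I (a * x)].

Definition is_prime I := [/\ is_ideal I, ~ I 1 &
  forall x y, I (x * y) -> I x \/ I y].

Definition is_real I := forall (n : nat) (a : 'I_n -> A),
  I (\sum_(i < n) a i ^+ 2) -> forall i, I (a i).

Record SpecR := RealPrime {
  prime_set : set A;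
  SpecR_prime : is_prime prime_set;
  SpecR_real : is_real prime_set }.

HB.instance Definition _ := gen_eqMixin SpecR.
HB.instance Definition _ := gen_choiceMixin SpecR.

Definition V I : set SpecR := [set p : SpecR | I `<=` prime_set p].

Definition SpecR_open : set_system SpecR :=
  [set U | exists2 I, is_ideal I & U = ~` V I].

Fact SpecR_openT : SpecR_open setT.
Proof.
exists setT => //; apply/esym/seteqP; split=> // p _ /(_ 1 Logic.I).
by have [] := SpecR_prime p.
Qed.

Fact SpecR_openI : setI_closed SpecR_open.
Proof.
move=> _ _ [I Iid ->] [J Jid ->]; exists (I `&` J).
  case: Iid Jid => I0 ID IM [J0 JD JM].
  split=> [//|x y [? ?] [? ?]|a x [? ?]]; split; auto.
rewrite -setCU; congr (~` _); apply/seteqP; split=> p.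
  by move=> [|] s x [? ?]; exact: s.
move=> IJp; apply: contrapT => /not_orP[].
move=> /existsNP[x /not_implyP[Ix px]] /existsNP[y /not_implyP[Jy py]].
have [_ _ pp] := SpecR_prime p.
have pxy : prime_set p (x * y).
  apply: IJp; split; last by case: Jid => _ _; apply.
  by rewrite mulrC; case: Iid => _ _; apply.
by have [] := pp _ _ pxy.
Qed.

Fact SpecR_open_bigU (K : Type) (F : K -> set SpecR) :
  (forall k, SpecR_open (F k)) -> SpecR_open (\bigcup_k F k).
Proof.
move=> Fop.
pose G := [set J | is_ideal J /\ exists2 k, F k = ~` V J & True].
pose I := \bigcap_(L in [set L | is_ideal L /\ forall J, G J -> J `<=` L]) L.
exists I.
  split.
  - by move=> L [[]].
  - by move=> x y Ix Iy L LG; have [[_ LD _] _] := LG; apply: LD; [exact: Ix|exact: Iy].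
  - by move=> a x Ix L LG; have [[_ _ LM] _] := LG; apply: LM; exact: Ix.
apply/seteqP; split=> p.
  move=> [k _ Fkp] Ip; have [J Jid FJ] := Fop k.
  rewrite FJ in Fkp; apply: Fkp; apply: subset_trans Ip => x Jx L [_ GL].
  by apply: (GL J) => //; split=> //; exists k.
move=> nIp; apply: contrapT => nF; apply: nIp => x Ix.
apply: Ix; split; first by have [] := SpecR_prime p.
move=> J [Jid [k Fk _]].
by apply: contrapT => Jp; apply: nF; exists k => //; rewrite Fk.
Qed.

HB.instance Definition _ := isOpenTopological.Build SpecR
  SpecR_openT SpecR_openI SpecR_open_bigU.

Lemma SpecR_openE (U : set SpecR) :
  open U <-> exists2 I, is_ideal I & U = ~` V I.
Proof. by []. Qed.

Definition prime_compl (p : SpecR) : {pred A} := fun x => `[< ~ prime_set p x >].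

Fact prime_compl_mulr_closed p : mulr_closed (prime_compl p).
Proof.
have [_ p1 pM] := SpecR_prime p; split=> [|x y]; rewrite !unfold_in.
  exact/asboolP.
by move=> /asboolP px /asboolP py; apply/asboolP => /pM[].
Qed.

HB.instance Definition _ p := GRing.isMulClosed.Build A (prime_compl p)
  (prime_compl_mulr_closed p).

Definition stalk (p : SpecR) := loc (prime_compl p).
HB.instance Definition _ p := GRing.ComPzRing.on (stalk p).

End RealIdeals.

Record opens (T : topologicalType) := Opens {
  opens_set :> set T;
  opens_open : open opens_set }.

Section StructureSheaf.
Variable A : comPzRingType.

(* Functions s from U to the disjoint union of the A_p such that s(p) lies in
   A_p, i.e. dependent functions, with the pointwise ring structure. *)
Section StalkFamily.
Variable U : opens (SpecR A).

Definition stalk_family := forall p : U, stalk (val p).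
HB.instance Definition _ := gen_eqMixin stalk_family.
HB.instance Definition _ := gen_choiceMixin stalk_family.

Implicit Types s t : stalk_family.

Definition sf0 : stalk_family := fun=> 0.
Definition sf1 : stalk_family := fun=> 1.
Definition sf_opp s : stalk_family := fun p => - s p.
Definition sf_add s t : stalk_family := fun p => s p + t p.
Definition sf_mul s t : stalk_family := fun p => s p * t p.

Fact sf_addA : associative sf_add.
Proof. by move=> s t u; apply: functional_extensionality_dep => p; exact: addrA. Qed.
Fact sf_addC : commutative sf_add.
Proof. by move=> s t; apply: functional_extensionality_dep => p; exact: addrC. Qed.
Fact sf_add0 : left_id sf0 sf_add.
Proof. by move=> s; apply: functional_extensionality_dep => p; exact: add0r. Qed.
Fact sf_addN : left_inverse sf0 sf_opp sf_add.
Proof. by move=> s; apply: functional_extensionality_dep => p; exact: addNr. Qed.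

HB.instance Definition _ :=
  GRing.isZmodule.Build stalk_family sf_addA sf_addC sf_add0 sf_addN.

Fact sf_mulA : associative sf_mul.
Proof. by move=> s t u; apply: functional_extensionality_dep => p; exact: mulrA. Qed.
Fact sf_mulC : commutative sf_mul.
Proof. by move=> s t; apply: functional_extensionality_dep => p; exact: mulrC. Qed.
Fact sf_mul1 : left_id sf1 sf_mul.
Proof. by move=> s; apply: functional_extensionality_dep => p; exact: mul1r. Qed.
Fact sf_mulDl : left_distributive sf_mul sf_add.
Proof. by move=> s t u; apply: functional_extensionality_dep => p; exact: mulrDl. Qed.

HB.instance Definition _ := GRing.Zmodule_isComPzRing.Build stalk_family
  sf_mulA sf_mulC sf_mul1 sf_mulDl.

Definition locally_fraction : {pred stalk_family} := fun s =>
  `[< forall p : U, exists W : set (SpecR A),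
      [/\ open W, W (val p), W `<=` U &
          exists a g : A, forall q : U, W (val q) ->
            exists hg : g \in prime_compl (val q), s q = frac a hg] >].

Fact locally_fraction_subring_closed : subring_closed locally_fraction.
Proof.
split=> [|s t|s t]; rewrite !unfold_in.
- apply/asboolP => p; exists (U : set _); split=> //; first exact: opens_open.
    exact: set_valP.
  by exists 1, 1 => q _; exists (rpred1 _).
- move=> /asboolP hs /asboolP ht; apply/asboolP => p.
  have [W [Wo Wp WU [a [g sW]]]] := hs p; have [W' [Wo' Wp' _ [b [h tW]]]] := ht p.
  exists (W `&` W'); split=> //; first exact: openI.
    by move=> x [/WU].
  exists (a * h - b * g), (g * h) => q [/sW[hg sq] /tW[hh tq]].
  exists (rpredM hg hh).
  have -> : (s - t) q = s q - t q by [].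
  by rewrite sq tq fracN fracD mulNr.
- move=> /asboolP hs /asboolP ht; apply/asboolP => p.
  have [W [Wo Wp WU [a [g sW]]]] := hs p; have [W' [Wo' Wp' _ [b [h tW]]]] := ht p.
  exists (W `&` W'); split=> //; first exact: openI.
    by move=> x [/WU].
  exists (a * b), (g * h) => q [/sW[hg sq] /tW[hh tq]].
  exists (rpredM hg hh).
  have -> : (s * t) q = s q * t q by [].
  by rewrite sq tq fracM.
Qed.

HB.instance Definition _ := GRing.isSubringClosed.Build stalk_family
  locally_fraction locally_fraction_subring_closed.

(* O_X(U) *)
Record sections := MkSection {
  section_fun : stalk_family;
  sectionP : section_fun \in locally_fraction }.

HB.instance Definition _ := [isSub for section_fun].
HB.instance Definition _ := [Choice of sections by <:].
HB.instance Definition _ := 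
  GRing.SubChoice_isSubComPzRing.Build _ _ sections (subringClosedP _).

End StalkFamily.

End StructureSheaf.

Section Psi.
Variables (A : comPzRingType) (f : A).

Definition Dset : set (SpecR A) := [set p : SpecR A | ~ prime_set p f].

Fact open_Dset : open Dset.
Proof.
apply/SpecR_openE; exists [set x | exists a, x = a * f].
  split=> [|x y [a ->] [b ->]|a x [b ->]].
  - by exists 0; rewrite mul0r.
  - by exists (a + b); rewrite mulrDl.
  - by exists (a * b); rewrite mulrA.
apply/seteqP; split=> p /= h h'; apply: h.
  by apply: h'; exists 1; rewrite mul1r.
by move=> _ [a ->]; have [[_ _ pM] _ _] := SpecR_prime p; exact: pM.
Qed.

Definition D : opens (SpecR A) := Opens open_Dset.

Definition Sigma : {pred A} := fun x => `[< exists (m n : nat) (a : 'I_n.+1 -> A),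
  x = f ^+ (2 * m) + \sum_(i < n.+1) a i ^+ 2 >].

Lemma SigmaP x : x \in Sigma <->
  exists m (l : seq A), x = f ^+ (2 * m) + \sum_(a <- l) a ^+ 2.
Proof.
split=> [/asboolP[m [n [a ->]]]|[m [l ->]]].
  by exists m, [seq a i | i <- index_enum 'I_n.+1]; rewrite big_map.
apply/asboolP; exists m, (size l), (fun i => (0 :: l)`_i); congr (_ + _).
by rewrite -(big_mkord xpredT (fun i => (0 :: l)`_i ^+ 2)) big_nat_recl//=
  expr0n add0r (big_nth 0).
Qed.

Fact Sigma_mulr_closed : mulr_closed Sigma.
Proof.
split=> [|_ _ /SigmaP[m [l ->]] /SigmaP[k [r ->]]].
  by apply/SigmaP; exists 0%N, [::]; rewrite big_nil muln0 expr0 addr0.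
apply/SigmaP; exists (m + k)%N,
  ([seq f ^+ m * b | b <- r] ++ [seq f ^+ k * a | a <- l]
   ++ [seq a * b | a <- l, b <- r]).
rewrite !big_cat !big_map big_allpairs_dep mulrDl !mulrDr -exprD -mulnDr -!addrA.
congr (_ + _); congr (_ + (_ + _)).
- by rewrite mulr_sumr; apply: eq_bigr => b _; rewrite exprMn -exprM mulnC.
- by rewrite mulr_suml; apply: eq_bigr => a _; rewrite exprMn -exprM mulnC mulrC.
- rewrite mulr_suml; apply: eq_bigr => a _.
  by rewrite mulr_sumr; apply: eq_bigr => b _; rewrite exprMn.
Qed.

HB.instance Definition _ := GRing.isMulClosed.Build A Sigma Sigma_mulr_closed.

Fact Sigma_prime_compl (p : D) : {subset Sigma <= prime_compl (val p)}.
Proof.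
move=> _ /asboolP[m [n [a ->]]]; apply/asboolP => pS; apply: (set_valP p).
have [[_ _ _] p1 pM] := SpecR_prime (val p).
have : prime_set (val p) (f ^+ m).
  pose b (i : 'I_n.+2) := if unlift ord0 i is Some j then a j else f ^+ m.
  have := @SpecR_real _ (val p) _ b _ ord0; rewrite /b unlift_none; apply.
  rewrite big_ord_recl unlift_none -exprM mulnC.
  by under eq_bigr do rewrite liftK.
elim: m {pS} => [//|m IH]; rewrite exprS.
by case/pM.
Qed.

Definition psi_family (x : loc Sigma) : stalk_family D :=
  fun p => loc_map (@Sigma_prime_compl p) x.

Fact psi_family_locally_fraction x : psi_family x \in @locally_fraction A D.
Proof.
have [a [s [hs ->]]] := frac_surj x; apply/asboolP => p.
exists D; split=> //; first exact: opens_open.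
  exact: set_valP.
exists a, s => q _; exists (Sigma_prime_compl q hs).
exact: loc_map_frac.
Qed.

Definition psi (x : loc Sigma) : sections D :=
  MkSection (psi_family_locally_fraction x).

Lemma psi_frac a s (hs : s \in Sigma) (p : D) :
  section_fun (psi (frac a hs)) p = frac a (Sigma_prime_compl p hs).
Proof. exact: loc_map_frac. Qed.

Fact psi_is_zmod_morphism : zmod_morphism psi.
Proof.
move=> x y; apply: val_inj; apply: functional_extensionality_dep => p.
exact: (raddfB (loc_map (@Sigma_prime_compl p))).
Qed.

Fact psi_is_monoid_morphism : monoid_morphism psi.
Proof.
split=> [|x y]; apply: val_inj; apply: functional_extensionality_dep => p.
  exact: (rmorph1 (loc_map (@Sigma_prime_compl p))).
exact: (rmorphM (loc_map (@Sigma_prime_compl p))).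
Qed.

HB.instance Definition _ := GRing.isZmodMorphism.Build (loc Sigma) (sections D)
  psi psi_is_zmod_morphism.
HB.instance Definition _ := GRing.isMonoidMorphism.Build (loc Sigma) (sections D)
  psi psi_is_monoid_morphism.

End Psi.

Arguments psi {A} f x.

(* Main.v *)
Require Import Defs.
From mathcomp Require Import all_boot all_algebra.
From mathcomp Require Import ring.
From mathcomp Require Import all_classical.

(* If a / s vanishes in every stalk over D(f), then the annihilator of a lies in
   no real prime avoiding f. By the abstract real Nullstellensatz the annihilator
   then meets Sigma_f, that is, a / s = 0: an ideal maximal among those disjoint
   from Sigma_f is a real prime, because Sigma_f is multiplicative and stable
   under adding sums of squares. *)

Set Implicit Arguments.
Unset Strict Implicit.
Unset Printing Implicit Defensive.

Import GRing.Theory.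
Local Open Scope classical_set_scope.
Local Open Scope ring_scope.

Section MaximalDisjointIdeals.
Variable A : comPzRingType.
Implicit Types (I J M S : set A) (a b x y : A).

Definition annihilator a : set A := [set x | x * a = 0].

Lemma annihilator_ideal a : is_ideal (annihilator a).
Proof.
split=> [|x y|b x] /=; rewrite /annihilator /=.
- exact: mul0r.
- by move=> xa ya; rewrite mulrDl xa ya addr0.
- by move=> xa; rewrite -mulrA xa mulr0.
Qed.

(** For an ideal [I] this is the sum I + Ax. *)
Definition ideal_adjoin I x : set A :=
  [set z | exists2 y, I y & exists a, z = y + a * x].

Lemma ideal_adjoin_ideal I x : is_ideal I -> is_ideal (ideal_adjoin I x).
Proof.
move=> [I0 ID IM]; split=> [|_ _ [y Iy [a ->]] [z Iz [b ->]]|c _ [y Iy [a ->]]].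
- by exists 0 => //; exists 0; ring.
- by exists (y + z); [exact: ID | exists (a + b); ring].
- by exists (c * y); [exact: IM | exists (c * a); ring].
Qed.

Lemma sub_ideal_adjoin I x : I `<=` ideal_adjoin I x.
Proof. by move=> y Iy; exists y => //; exists 0; ring. Qed.

Lemma mem_ideal_adjoin I x : is_ideal I -> ideal_adjoin I x x.
Proof. by move=> [I0 _ _]; exists 0 => //; exists 1; ring. Qed.

Definition maximal_disjoint S M := [/\ is_ideal M, M `&` S = set0 &
  forall J, is_ideal J -> M `<` J -> J `&` S !=set0].

Lemma exists_maximal_disjoint S I : is_ideal I -> I `&` S = set0 ->
  exists2 M, I `<=` M & maximal_disjoint S M.
Proof.
move=> Iid IS.
(* The union with I makes the empty chain harmless in Zorn's lemma. *)
pose P X := is_ideal (I `|` X) /\ (I `|` X) `&` S = set0.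
have [F FP Ftot|X [[Mid MS] Xmax]] := @Zorn_bigcup _ P.
  have [I0 ID IM] := Iid.
  have FI X : F X -> I `|` X `<=` I `|` \bigcup_(Y in F) Y.
    by move=> FX; apply: setUS => x Xx; exists X.
  split; first split.
  - by left.
  - move=> x y [Ix|[X FX Xx]] [Iy|[Y FY Yy]].
    + by left; exact: ID.
    + have [[_ YD _] _] := FP _ FY.
      by apply: (FI Y) => //; apply: YD; [left | right].
    + have [[_ XD _] _] := FP _ FX.
      by apply: (FI X) => //; apply: XD; [right | left].
    (* The larger of [X] and [Y] in the chain contains both elements. *)
    + have [Z [FZ Zx Zy]] : exists Z, [/\ F Z, Z x & Z y].
        have [XY|YX] := Ftot _ _ FX FY; first by exists Y; split=> //; exact: XY.
        by exists X; split=> //; exact: YX.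
      have [[_ ZD _] _] := FP _ FZ.
      by apply: (FI Z) => //; apply: ZD; right.
  - move=> a x [Ix|[X FX Xx]]; first by left; exact: IM.
    have [[_ _ XM] _] := FP _ FX.
    by apply: (FI X) => //; apply: XM; right.
  - apply/seteqP; split=> // x [[Ix|[X FX Xx]] Sx]; first by rewrite -IS.
    by have [_ <-] := FP _ FX; split=> //; right.
exists (I `|` X) => //; split=> // J Jid [MJ JM].
(* If [J] missed [S], it would satisfy [P], since it contains [I], and it would properly contain
   [X]. *)
apply: contrapT => JS; apply: (Xmax J).
  split=> [x Xx|JX]; first by apply: MJ; right.
  by apply: JM => x /JX; right.
have IJ : I `|` J = J by apply: setUidr => x Ix; apply: MJ; left.
rewrite /P IJ; split=> //.
by apply: contrapT => /eqP/set0P.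
Qed.

(** By maximality, the strictly larger ideal M + Ax meets [S]. *)
Lemma maximal_disjoint_adjoin S M x : maximal_disjoint S M -> ~ M x ->
  exists2 s, S s & exists2 y, M y & exists a, s = y + a * x.
Proof.
move=> [Mid _ Mmax] Mx.
have [|s [Js Ss]] := Mmax _ (ideal_adjoin_ideal x Mid); last by exists s.
split; first exact: sub_ideal_adjoin.
by move/(_ x (mem_ideal_adjoin x Mid)).
Qed.

(** If [x] and [y] lie outside [M], both M + Ax and M + Ay meet [S]. The product of the two elements
    found lies in [S] and in M + Axy, which would be [M] if it contained [x * y]. *)
Lemma maximal_disjoint_prime (S : mulrClosed A) M :
  maximal_disjoint [set x | x \in S] M -> is_prime M.
Proof.
move=> Mmax; have [Mid MS _] := Mmax.
have disj x : M x -> x \in S -> False.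
  by move=> Mx Sx; rewrite -[False]/(set0 x) -MS.
have [_ MD MM] := Mid; split=> // [M1|x y Mxy].
  by apply: (disj 1) => //; exact: rpred1.
apply: contrapT => /not_orP[Mx My].
have [s /= Ss [u Mu [a es]]] := maximal_disjoint_adjoin Mmax Mx.
have [t /= St [v Mv [b et]]] := maximal_disjoint_adjoin Mmax My.
apply: (disj (s * t)); last exact: rpredM.
have -> : s * t = t * u + (a * x * v + a * b * (x * y)) by rewrite es et; ring.
by apply: (MD); [|apply: MD]; exact: MM.
Qed.

(* If s = y + a b_i lies in S with y in M, then s^2 - a^2 b_i^2 lies in M, hence
   so does s^2 plus the remaining terms of a^2 (sum of the b_j^2). *)
Lemma maximal_disjoint_real (S : mulrClosed A) M :
  (forall s x, s \in S -> s + x ^+ 2 \in S) ->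
  maximal_disjoint [set x | x \in S] M -> is_real M.
Proof.
move=> SD Mmax n b Mb i; have [[_ MD MM] MS _] := Mmax.
apply: contrapT => Mbi.
have [s /= Ss [y My [a es]]] := maximal_disjoint_adjoin Mmax Mbi.
pose t := s * s + \sum_(j < n | j != i) (a * b j) ^+ 2.
suff: [set x | x \in S] t /\ M t by case=> St Mt; rewrite -[False]/(set0 t) -MS.
split; rewrite /t /=.
  apply: (big_rec (fun z => s * s + z \in S)); first by rewrite addr0 rpredM.
  by move=> j z _ Sz; rewrite addrCA addrC; exact: SD.
(* Since [y] is [s - a * b i], the first product equals s^2 - a^2 b_i^2, and the subtracted square
   cancels the [i]-th term of the full sum. *)
have -> : s * s + \sum_(j < n | j != i) (a * b j) ^+ 2 =
    (s + a * b i) * y + a ^+ 2 * \sum_(j < n) b j ^+ 2.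
  rewrite [in RHS](bigD1 i) //= mulrDr mulr_sumr.
  under eq_bigr do rewrite exprMn.
  by rewrite es; ring.
by apply: MD; exact: MM.
Qed.

End MaximalDisjointIdeals.

Section RealNullstellensatz.
Variables (A : comPzRingType) (f : A).

Lemma SigmaDsqr s x : s \in Sigma f -> s + x ^+ 2 \in Sigma f.
Proof.
move=> /SigmaP[m [l ->]]; apply/SigmaP; exists m, (x :: l).
by rewrite big_cons addrCA addrC.
Qed.

Lemma sqr_Sigma : f ^+ 2 \in Sigma f.
Proof. by apply/SigmaP; exists 1, [::]; rewrite big_nil addr0. Qed.

(** Otherwise an ideal above [I], maximal among those disjoint from [Sigma f], is a real prime. It
    then contains [f], hence [f ^+ 2], which belongs to [Sigma f]. *)
Lemma real_nullstellensatz (I : set A) : is_ideal I ->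
  (forall p : SpecR A, I `<=` prime_set p -> prime_set p f) ->
  exists2 s, s \in Sigma f & I s.
Proof.
move=> Iid If; apply: contrapT => IS.
have IS0 : I `&` [set x | x \in Sigma f] = set0.
  by apply/seteqP; split=> // x [Ix Sx]; apply: IS; exists x.
have [M IM Mmax] := exists_maximal_disjoint Iid IS0.
have Mp := maximal_disjoint_prime Mmax.
have Mr := maximal_disjoint_real SigmaDsqr Mmax.
have /= Mf := If (RealPrime Mp Mr) IM.
have [[_ _ MM] MS _] := Mmax.
rewrite -[False]/(set0 (f ^+ 2)) -MS; split; last exact: sqr_Sigma.
exact: MM.
Qed.

End RealNullstellensatz.

Theorem mainTheorem2 (A : comPzRingType) (f : A) :
  injective (psi f : {rmorphism loc (Sigma f) -> sections (D f)}).
Proof.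
apply: raddf_inj => x; have [a [s [hs ->]]] := frac_surj x => psi0.
have [p ap|u Su ua] := real_nullstellensatz (f := f) (annihilator_ideal a).
  (* If [p] avoided [f], the vanishing of a/s in the stalk at [p] would give [u] outside [p] with
     [u * s] annihilating [a]. Then [u * s] lies in [p] although neither factor does. *)
  apply: contrapT => pf.
  pose q : D f := exist _ p (mem_set (pf : (D f : set _) p)).
  have : section_fun (psi f (Defs.frac a hs)) q = 0 by rewrite psi0.
  rewrite psi_frac -(frac0 (Sigma_prime_compl q hs)) => /fracP[u].
  move=> /asboolP pu; rewrite mul0r subr0 mulrA => uas.
  have [_ _ pM] := SpecR_prime p.
  have /asboolP ps := Sigma_prime_compl q hs.
  have: prime_set p (u * s) by apply: ap; rewrite /annihilator /= mulrAC.
  by case/pM.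
rewrite -(frac0 hs); apply/fracP; exists u => //.
by rewrite mul0r subr0 mulrA ua mul0r.
Qed.
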